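(* For $0<a<\frac12$ let $w_a$ be the first positive root of the equation $\tan\!\big(x(\tfrac12-a)\big)=1+\frac{1}{ax}$, and define $g_a:[0,1]\to\mathbb{R}$ by $$g_a(x)=\begin{cases} e^{2w_a(x-a)} & 0\le x<a,\\ 1 & a\le x\le 1-a,\\ e^{2w_a(1-x-a)} & 1-a<x\le1.\end{cases}$$ Then $\mu_1(g_a)=w_a^2$, and therefore $\lim_{a\to\frac12^-}\mu_1(g_a)=+\infty$.
   Context: For a non-negative $h\in L^\infty(0,1)$, $$\mu_k(h)=\inf_{E_k}\sup_{0\neq u\in E_k}\frac{\int_0^1(u')^2h\,dx}{\int_0^1u^2h\,dx},\qquad k\ge1,$$ the infimum being over all $k$-dimensional subspaces $E_k$ of $H^1(0,1)$ with $\int_0^1uh\,dx=0$ for all $u\in E_k$. (For $h$ bounded below by a positive constant, $\mu_1(h)$ is the first nonzero eigenvalue of $-(hu')'=\mu hu$ on $(0,1)$, $u'(0)=u'(1)=0$.) *)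

(* Defs.v *)
From mathcomp Require Import all_boot all_order all_algebra.
From mathcomp Require Import all_classical all_reals all_analysis.

Set Implicit Arguments.
Unset Strict Implicit.
Unset Printing Implicit Defensive.

Import Order.TTheory GRing.Theory Num.Theory.
Import numFieldNormedType.Exports.

Local Open Scope classical_set_scope.
Local Open Scope ring_scope.

(* Functions on (0,1) are represented by total functions R -> R whose values
   outside the interval are never used. *)
Definition unit_itv (R : realType) : set R := `]0, 1[%classic.
Arguments unit_itv R : clear implicits.

Definition ae_equal (R : realType) (u v : R -> R) : Prop :=
  ae_eq (@lebesgue_measure R) (unit_itv R) u v.

Definition square_integrable (R : realType) (u : R -> R) : Prop :=
  measurable_fun (unit_itv R) u /\
  (\int[@lebesgue_measure R]_(x in unit_itv R) ((u x) ^+ 2)%:E < +oo)%E.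

(* phi belongs to C^1_c(0,1), extended by 0 outside (0,1).  As in
   Brezis' textbook, H^1(0,1) is defined by testing against C^1_c; testing
   against C^infty_c yields the same space and the same weak derivatives. *)
Definition test_function (R : realType) (phi : R -> R) : Prop :=
  [/\ forall x, derivable phi x 1,
      continuous (derive1 phi),
      compact (closure [set x | phi x != 0]) &
      closure [set x | phi x != 0] `<=` unit_itv R].

Definition weak_derivative (R : realType) (u v : R -> R) : Prop :=
  forall phi : R -> R, test_function phi ->
    (\int[@lebesgue_measure R]_(x in unit_itv R) (u x * derive1 phi x)%:E =
     - \int[@lebesgue_measure R]_(x in unit_itv R) (v x * phi x)%:E)%E.

Definition sobolev_H1 (R : realType) : set (R -> R) :=
  [set u | square_integrable u /\
           exists2 v, square_integrable v & weak_derivative u v].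
Arguments sobolev_H1 R : clear implicits.

Definition lin_comb (R : realType) (k : nat) (b : 'I_k -> R -> R)
    (c : 'I_k -> R) : R -> R :=
  fun x => \sum_(i < k) c i * b i x.

(* H^1(0,1) consists of classes modulo a.e. equality, so a k-dimensional
   subspace is given by representatives: the span of k functions that are
   linearly independent modulo a.e. equality. *)
Definition H1_subspace (R : realType) (k : nat) (E : set (R -> R)) : Prop :=
  E `<=` sobolev_H1 R /\
  exists b : 'I_k -> R -> R,
    (forall c : 'I_k -> R, ae_equal (lin_comb b c) (cst 0) ->
       forall i, c i = 0) /\
    E = range (lin_comb b).

(* q is the Rayleigh quotient of u.  The weak derivative v is unique up to
   a.e. equality, hence so is q.  In \bar R, c / 0 = +oo for c > 0 and
   0 / 0 = 0; this only matters for weights h that vanish somewhere. *)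
Definition rayleigh (R : realType) (h u : R -> R) (q : \bar R) : Prop :=
  exists v : R -> R,
    [/\ square_integrable v, weak_derivative u v &
        (q = (\int[@lebesgue_measure R]_(x in unit_itv R) (v x ^+ 2 * h x)%:E) /
             (\int[@lebesgue_measure R]_(x in unit_itv R)
                 (u x ^+ 2 * h x)%:E))%E].

Definition weighted_mean_zero (R : realType) (h : R -> R)
    (E : set (R -> R)) : Prop :=
  forall u, E u ->
    (\int[@lebesgue_measure R]_(x in unit_itv R) (u x * h x)%:E = 0)%E.

(* Meaningful for k >= 1 and h non-negative, measurable and essentially
   bounded on (0,1). *)
Definition mu_ (R : realType) (k : nat) (h : R -> R) : \bar R :=
  ereal_inf [set s | exists E : set (R -> R),
    [/\ H1_subspace k E, weighted_mean_zero h E &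
        s = ereal_sup [set q | exists u : R -> R,
              [/\ E u, ~ ae_equal u (cst 0) & rayleigh h u q]]]].

(* At the poles of tan the library's value is 0, which is not a solution of
   the equation for a, x > 0, so no spurious root arises. *)
Definition root_eq (R : realType) (a x : R) : Prop :=
  tan (x * (2^-1 - a)) = 1 + (a * x)^-1.

Definition first_positive_root (R : realType) (a w : R) : Prop :=
  [/\ 0 < w, root_eq a w & forall x, 0 < x -> root_eq a x -> w <= x].

Definition w_ (R : realType) (a : R) : R := xget 0 (first_positive_root a).

Definition g_ (R : realType) (a : R) : R -> R := fun x =>
  if x < a then expR (2 * w_ a * (x - a))
  else if x <= 1 - a then 1
  else expR (2 * w_ a * (1 - x - a)).

(* Main.v *)
Require Import Defs.
From mathcomp Require Import all_boot all_order all_algebra.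
From mathcomp Require Import all_classical all_reals all_analysis.
From mathcomp Require Import measurable_realfun ring lra.
Import Order.TTheory GRing.Theory Num.Theory.
Import numFieldNormedType.Exports.
Local Open Scope classical_set_scope.
Local Open Scope ring_scope.

(* Suppose y solves -(h y')' = l h y with flux G = h y' negative on (0,1) and
   zero at both ends.  Then mu_1(h) = l.  The span of y gives the upper bound.
   For the lower bound, let u have weighted mean zero and weak derivative v, and
   let eta in C_c(0,1) have mean zero: its primitive P is a test function, so
   int u eta = - int v P.  Since q = - l y / G solves the Riccati equation
   q' = - l / h - h q^2, one has
     eta^2 / h - l P^2 / h = (eta - h q P)^2 / h + (P^2 q)',
   whence l int P^2 / h <= int eta^2 / h.  Young's inequality then yields
   l (2 int u eta - int eta^2 / h) <= int v^2 h, and completing the square while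
   eta tends to u h in L^2 gives l int u^2 h <= int v^2 h.
   For h = g_a the solution is explicit: up to a constant
   (1 + w x) exp(- w (x - a)) on [0, a], sin (w (1/2 - x)) in the middle, and
   extended oddly about 1/2; the equation for w is exactly the matching condition
   at a. *)

Set Implicit Arguments.
Unset Strict Implicit.
Unset Printing Implicit Defensive.

(** * Square-integrable functions on (0,1) *)

Section square_integrable_functions.
Context {R : realType}.
Implicit Types (f g u v : R -> R).
Local Notation mu := (@lebesgue_measure R).
Local Notation D := (unit_itv R).
Local Notation "\I_ ( x ) f" := (\int[mu]_(x in D) f)%R
  (at level 36, x name, f at level 36).
Local Notation intD f := (mu.-integrable D (EFin \o f)).

(* [R] and [measurableTypeR R], the domain of [lebesgue_measure], carry the same
   sigma-algebra under different displays; both forms are needed. *)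
Lemma measurable_unit_itv : measurable (D : set (measurableTypeR R)).
Proof. exact: measurable_itv. Qed.
Hint Resolve measurable_unit_itv : core.

Lemma measurable_unit_itv_default : measurable D.
Proof. exact: measurable_itv. Qed.
Hint Resolve measurable_unit_itv_default : core.

Lemma measure_unit_itv : mu D = 1%E.
Proof. by rewrite /unit_itv lebesgue_measure_itv/= lte_fin ltr01 oppr0 adde0. Qed.

Lemma Rintegral_unit_cst r : \I_(x) r = r.
Proof.
rewrite Rintegral_cst// [X in _ * fine X](_ : _ = 1%E) ?mulr1//.
exact: measure_unit_itv.
Qed.

Lemma integrable_EFin_le f g : measurable_fun D f -> intD g ->
  (forall x, D x -> `|f x| <= g x) -> intD f.
Proof.
move=> mf ig fg; apply: le_integrable ig => //; first exact/measurable_EFinP.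
by move=> x Dx /=; rewrite lee_fin (le_trans (fg x Dx))// ler_norm.
Qed.

Lemma Rintegral_EFin f : intD f ->
  (\int[mu]_(x in D) (f x)%:E = (\I_(x) f x)%:E)%E.
Proof. by move=> fi; rewrite fineK//; exact: integrable_fin_num. Qed.

Lemma square_integrable_sqr u : square_integrable u -> intD (fun x => u x ^+ 2).
Proof.
move=> [mu2 iu]; apply/integrableP; split.
  by apply/measurable_EFinP; exact: measurable_funX.
under eq_integral do rewrite /= ger0_norm ?sqr_ge0//.
exact: iu.
Qed.

Lemma sqr_square_integrable u : measurable_fun D u ->
  intD (fun x => u x ^+ 2) -> square_integrable u.
Proof.
move=> mu2 iu; split=> //; rewrite Rintegral_EFin//; exact: ltry.
Qed.

Lemma square_integrable_le u v : measurable_fun D u -> square_integrable v ->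
  (forall x, D x -> `|u x| <= `|v x|) -> square_integrable u.
Proof.
move=> mu2 Lv uv; apply: sqr_square_integrable => //.
apply: (@integrable_EFin_le _ (fun x => v x ^+ 2)).
- exact: measurable_funX.
- exact: square_integrable_sqr.
- by move=> x Dx; rewrite normrX -[leRHS]real_normK ?num_real// ler_sqr ?nnegrE ?uv.
Qed.

Lemma integrable_mul_square_integrable u v :
  square_integrable u -> square_integrable v -> intD (fun x => u x * v x).
Proof.
move=> Lu Lv; apply: (@integrable_EFin_le _ (fun x => u x ^+ 2 + v x ^+ 2)).
- by apply: measurable_funM; [case: Lu|case: Lv].
- have := integrableD measurable_unit_itv (square_integrable_sqr Lu)
    (square_integrable_sqr Lv).
  by apply: eq_integrable.
- move=> x _; rewrite ler_norml; apply/andP; split; nra.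
Qed.

Lemma square_integrableZ r u : square_integrable u ->
  square_integrable (fun x => r * u x).
Proof.
move=> Lu; apply: sqr_square_integrable; first by apply: measurable_funM; case: Lu.
have := integrableZl measurable_unit_itv (r ^+ 2) (square_integrable_sqr Lu).
by apply: eq_integrable => //= x _; rewrite exprMn.
Qed.

Lemma square_integrableD u v : square_integrable u -> square_integrable v ->
  square_integrable (fun x => u x + v x).
Proof.
move=> Lu Lv; have mw : measurable_fun D (fun x => u x + v x).
  by apply: measurable_funD; [case: Lu|case: Lv].
apply: sqr_square_integrable => //.
apply: (@integrable_EFin_le _ (fun x => 2 * u x ^+ 2 + 2 * v x ^+ 2)).
- exact: measurable_funX.
- have := integrableD measurable_unit_itv
    (integrableZl measurable_unit_itv 2 (square_integrable_sqr Lu))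
    (integrableZl measurable_unit_itv 2 (square_integrable_sqr Lv)).
  by apply: eq_integrable.
- move=> x _; rewrite ger0_norm ?sqr_ge0//.
  by have := sqr_ge0 (u x - v x); nra.
Qed.

Lemma square_integrableB u v : square_integrable u -> square_integrable v ->
  square_integrable (fun x => u x - v x).
Proof.
move=> Lu Lv.
have := square_integrableD Lu (square_integrableZ (-1) Lv).
by under eq_fun do rewrite mulN1r.
Qed.

Lemma continuous_measurable_unit f : continuous f -> measurable_fun D f.
Proof.
by move=> /continuous_measurable_fun; exact: measurable_funS.
Qed.

Lemma continuous_unit_bounded f : continuous f ->
  exists2 M : R, 0 <= M & forall x, D x -> `|f x| <= M.
Proof.
move=> cf; have cn : {within `[0, 1]%classic, continuous (fun x => `|f x|)}.
  apply: continuous_subspaceT => x.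
  by apply: continuous_comp; [exact: cf|exact: norm_continuous].
have [c _ cM] := EVT_max ler01 cn.
exists `|f c| => // x; rewrite /unit_itv /= in_itv/= => /andP[x0 x1].
by apply: cM; rewrite in_itv/= !ltW.
Qed.

Lemma square_integrable_bounded u M : measurable_fun D u ->
  (forall x, D x -> `|u x| <= M) -> square_integrable u.
Proof.
move=> mu2 uM; apply: sqr_square_integrable => //.
apply: measurable_bounded_integrable => //.
- by have := measure_unit_itv; rewrite /= => ->; exact: ltry.
- exact: measurable_funX.
exists (M ^+ 2); split; rewrite ?num_real// => N /ltW MN x Dx.
rewrite /= (le_trans _ MN)// normrX ler_sqr ?nnegrE ?uM//.
by rewrite (le_trans _ (uM x Dx)).
Qed.

Lemma continuous_square_integrable f : continuous f -> square_integrable f.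
Proof.
move=> cf; have [M _ fM] := continuous_unit_bounded cf.
exact: square_integrable_bounded (continuous_measurable_unit cf) fM.
Qed.

Lemma square_integrableMr u f : square_integrable u -> continuous f ->
  square_integrable (fun x => f x * u x).
Proof.
move=> Lu cf; have [M M0 fM] := continuous_unit_bounded cf.
apply: (square_integrable_le _ (square_integrableZ M Lu)).
  by apply: measurable_funM; [exact: continuous_measurable_unit|case: Lu].
by move=> x Dx; rewrite !normrM ler_wpM2r// (le_trans (fM x Dx))// ler_norm.
Qed.

Lemma square_integrable1 : square_integrable (cst 1 : R -> R).
Proof. by apply: continuous_square_integrable => x; exact: cvg_cst. Qed.

Lemma square_integrable_integrable u : square_integrable u -> intD u.
Proof.
move=> Lu; have := integrable_mul_square_integrable square_integrable1 Lu.
by apply: eq_integrable => //= x _; rewrite mul1r.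
Qed.

Lemma sqr_Rintegral_le u : square_integrable u ->
  (\I_(x) u x) ^+ 2 <= \I_(x) u x ^+ 2.
Proof.
move=> Lu; set m := \I_(x) u x.
have iu := square_integrable_integrable Lu.
have iu2 := square_integrable_sqr Lu.
have i1 := square_integrable_integrable square_integrable1.
have im : intD (fun x => (2 * m) * u x).
  by have := integrableZl measurable_unit_itv (2 * m) iu; apply: eq_integrable.
have : 0 <= \I_(x) (u x - m) ^+ 2 by apply: Rintegral_ge0 => x _; exact: sqr_ge0.
have -> : \I_(x) (u x - m) ^+ 2 = \I_(x) ((u x ^+ 2 - 2 * m * u x) + m ^+ 2).
  by apply: eq_Rintegral => x _; ring.
rewrite RintegralD//; last 2 first.
  by have := integrableB measurable_unit_itv iu2 im; apply: eq_integrable.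
  by have := square_integrable_integrable (square_integrableZ (m ^+ 2) square_integrable1);
    apply: eq_integrable => //= x _; rewrite mulr1.
rewrite RintegralB// RintegralZl// Rintegral_unit_cst -/m; nra.
Qed.

End square_integrable_functions.

Section density.
Context {R : realType}.
Implicit Types (f g u v : R -> R) (d e : R).
Local Notation mu := (@lebesgue_measure R).
Local Notation D := (unit_itv R).
Local Notation "\I_ ( x ) f" := (\int[mu]_(x in D) f)%R
  (at level 36, x name, f at level 36).
Local Notation intD f := (mu.-integrable D (EFin \o f)).
Let mD : measurable (D : set (measurableTypeR R)) := @measurable_unit_itv R.
Let mD' : measurable D := @measurable_unit_itv_default R.
Hint Resolve mD mD' : core.

Lemma cvge0_exists_lt (s : nat -> \bar R) (e : R) :
  s n @[n --> \oo] --> 0%E -> 0 < e -> exists n, fine (s n) < e.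
Proof.
move=> /fine_cvgP[_ /cvgrPdist_lt/(_ e)] + e0 => /(_ e0)[n _ /(_ n (leqnn n))].
rewrite /= sub0r normrN => h; exists n; exact: le_lt_trans (ler_norm _) h.
Qed.

Definition truncation f (n : nat) x : R :=
  if (`|f x| <= n.+1%:R) && ((n.+1%:R^-1 <= x) && (x <= 1 - n.+1%:R^-1))
  then f x else 0.

Lemma measurable_truncation f n :
  measurable_fun D f -> measurable_fun D (truncation f n).
Proof.
move=> mf; apply: measurable_fun_if => //.
- apply: measurable_and; first by apply: measurable_fun_ler => //; exact: measurableT_comp.
  by apply: measurable_and; exact: measurable_fun_ler.
- apply: measurable_funS mf; last exact: subIsetl.
  exact: measurable_unit_itv_default.
Qed.

Lemma truncation_dist f n x : `|f x - truncation f n x| <= `|f x|.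
Proof.
by rewrite /truncation; case: ifP => _; rewrite ?subrr ?normr0 ?subr0.
Qed.

Lemma truncation_bound f n x : `|truncation f n x| <= n.+1%:R.
Proof. by rewrite /truncation; case: ifP => [/andP[]//|_]; rewrite normr0. Qed.

Lemma truncation_near f x : D x -> \forall n \near \oo, truncation f n x = f x.
Proof.
rewrite /unit_itv /= in_itv/= => /andP[x0 x1].
have x1' : 0 < 1 - x by rewrite subr_gt0.
near=> n; rewrite /truncation ifT//.
have nE : n%:R < n.+1%:R :> R by rewrite ltr_nat.
apply/and3P; split.
- by rewrite (le_trans _ (ltW nE))// ltW//; near: n; exact: nbhs_infty_gtr.
- rewrite invf_ple ?posrE// (le_trans _ (ltW nE))// ltW//.
  by near: n; exact: nbhs_infty_gtr.
- rewrite lerBrDr addrC -lerBrDr invf_ple ?posrE// (le_trans _ (ltW nE))// ltW//.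
  by near: n; exact: nbhs_infty_gtr.
Unshelve. all: by end_near. Qed.

Lemma truncation_approx f (e : R) : square_integrable f -> 0 < e ->
  exists n, \I_(x) (f x - truncation f n x) ^+ 2 < e.
Proof.
move=> Lf e0; have mf : measurable_fun D f by case: Lf.
have mt n : measurable_fun D (fun x => (f x - truncation f n x) ^+ 2).
  by apply: measurable_funX; apply: measurable_funB => //; exact: measurable_truncation.
have [| | | | |_ _] := @dominated_convergence _ _ _ mu D measurable_unit_itv
  (fun n x => ((f x - truncation f n x) ^+ 2)%:E) (cst 0%E) (fun x => (f x ^+ 2)%:E).
- by move=> n; apply/measurable_EFinP; exact: (mt n).
- exact: measurable_cst.
- apply: aeW => x Dx; apply: cvg_near_cst.
  have := truncation_near f Dx; apply: filterS => n ->.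
  by rewrite subrr expr0n.
- exact: square_integrable_sqr.
- apply: aeW => x n Dx; rewrite /= lee_fin ger0_norm ?sqr_ge0//.
  by rewrite -[leLHS]real_normK ?num_real// -[leRHS]real_normK ?num_real//
    ler_sqr ?nnegrE// truncation_dist.
- rewrite integral0 => /cvge0_exists_lt/(_ e0)[n ne].
  by exists n.
Qed.

Lemma continuous_maxr f g : continuous f -> continuous g ->
  continuous (fun x => Num.max (f x) (g x)).
Proof. by move=> cf cg x; exact: (continuous_max (cf x) (cg x)). Qed.

Lemma continuous_minr f g : continuous f -> continuous g ->
  continuous (fun x => Num.min (f x) (g x)).
Proof. by move=> cf cg x; exact: (continuous_min (cf x) (cg x)). Qed.

Lemma clamp_dist (a b c : R) : `|a| <= c -> `|a - Num.max (- c) (Num.min c b)| <= `|a - b|.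
Proof.
rewrite ler_norml => /andP[ca ac].
have n1 := ler_norm (a - b); have := ler_norm (b - a); rewrite distrC => n2.
have [bc|cb] := leP c b; last by have [h|h] := leP (- c) b; rewrite ler_norml;
  apply/andP; split; lra.
by rewrite max_r ?ler_norml; [apply/andP; split; lra|lra].
Qed.

Lemma clamp_bound (b c : R) : 0 <= c -> `|Num.max (- c) (Num.min c b)| <= c.
Proof.
move=> c0; rewrite ler_norml le_max lexx/= ge_max ge_min lexx/= andbT; lra.
Qed.

Definition plateau (d x : R) : R :=
  Num.max 0 (Num.min 1 (2 * d^-1 * Num.min x (1 - x) - 1)).

Lemma plateau_continuous d : continuous (plateau d).
Proof.
apply: continuous_maxr; first by move=> x; exact: cvg_cst.
apply: continuous_minr; first by move=> x; exact: cvg_cst.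
move=> x; apply: cvgB; last exact: cvg_cst.
apply: cvgM; first exact: cvg_cst.
apply: (@continuous_minr id (fun x => 1 - x)) => {}x; first exact: cvg_id.
by apply: cvgB; [exact: cvg_cst|exact: cvg_id].
Qed.

Lemma plateau_itv d x : 0 <= plateau d x <= 1.
Proof.
by rewrite /plateau le_max lexx/= ge_max ler01/= ge_min lexx.
Qed.

Lemma plateau1 d x : 0 < d -> d <= x -> x <= 1 - d -> plateau d x = 1.
Proof.
move=> d0 dx xd; have h : 1 <= d^-1 * Num.min x (1 - x).
  by rewrite mulrC ler_pdivlMr// mul1r le_min dx/= lerBrDr addrC -lerBrDr.
rewrite /plateau -mulrA min_l ?max_r ?ler01//; lra.
Qed.

Lemma plateau0 d x : 0 < d -> (x < d / 2) || (1 - d / 2 < x) -> plateau d x = 0.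
Proof.
move=> d0 xd; have h : d^-1 * Num.min x (1 - x) <= 2^-1.
  rewrite mulrC ler_pdivrMr// ge_min; case/orP: xd => h; apply/orP; [left|right]; lra.
by rewrite /plateau -mulrA max_l// ge_min; apply/orP; right; lra.
Qed.

Lemma continuous_L1_approx f (e : R) : intD f -> 0 < e ->
  exists2 g, continuous g & \I_(x) `|f x - g x| < e /\ intD g.
Proof.
move=> fi e0.
have [||//|g [cg ig]] := @approximation_continuous_integrable R D f.
- exact: measurable_unit_itv.
- by have := measure_unit_itv (R := R); rewrite /= => ->; exact: ltry.
by move=> /cvge0_exists_lt/(_ e0)[n ne]; exists (g n).
Qed.

Lemma square_integrable_approx f (e : R) : square_integrable f -> 0 < e ->
  exists g (d : R), [/\ continuous g, 0 < d,
    forall x : R, (x < d) || (1 - d < x) -> g x = 0 &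
    \I_(x) (f x - g x) ^+ 2 < e].
Proof.
move=> Lf e0; have [n nP] := truncation_approx Lf (divr_gt0 e0 (ltr0Sn _ 3)).
set t := truncation f n in nP; pose N : R := n.+1%:R.
have N0 : 0 < N by rewrite ltr0Sn.
have mt : measurable_fun D t by apply: measurable_truncation; case: Lf.
have Lt : square_integrable t.
  by apply: (square_integrable_bounded mt) => x _; exact: truncation_bound.
have e80 : 0 < e / (8 * N) by rewrite divr_gt0// mulr_gt0.
have [g cg [gP ig]] := continuous_L1_approx (square_integrable_integrable Lt) e80.
pose c x := Num.max (- N) (Num.min N (g x)).
have cc : continuous c.
  apply: continuous_maxr; first by move=> x; exact: cvg_cst.
  by apply: continuous_minr => // x; exact: cvg_cst.
pose h x := plateau N^-1 x * c x.
have ch : continuous h.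
  by move=> x; apply: cvgM; [exact: plateau_continuous|exact: cc].
exists h, (N^-1 / 2); split=> //.
- by rewrite divr_gt0// invr_gt0.
- by move=> x /plateau0 xd; rewrite /h xd ?mul0r// invr_gt0.
have th x : `|t x - h x| <= `|t x - g x|.
  rewrite /t /truncation /h; case: ifP => [/and3P[fN xN Nx]|_].
    rewrite plateau1// ?invr_gt0// mul1r; exact: clamp_dist.
  rewrite !sub0r !normrN normrM.
  have /andP[p0 p1] := plateau_itv N^-1 x; rewrite (ger0_norm p0).
  rewrite (@le_trans _ _ (1 * `|c x|))// ?ler_wpM2r// mul1r.
  have := @clamp_dist 0 (g x) N; rewrite normr0 !sub0r !normrN; apply.
  exact: ltW.
have hN x : `|h x| <= N.
  rewrite normrM; have /andP[p0 p1] := plateau_itv N^-1 x; rewrite (ger0_norm p0).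
  rewrite (@le_trans _ _ (1 * `|c x|))// ?ler_wpM2r// mul1r.
  exact/clamp_bound/ltW.
have Lh := continuous_square_integrable ch.
have i1 : intD (fun x => `|t x - g x|).
  have := integrable_norm (integrableB measurable_unit_itv
    (square_integrable_integrable Lt) ig).
  by apply: eq_integrable.
have i2 := square_integrable_sqr (square_integrableB Lt Lh).
have i3 := square_integrable_sqr (square_integrableB Lf Lt).
have i4 := square_integrable_sqr (square_integrableB Lf Lh).
have h2 : \I_(x) (t x - h x) ^+ 2 <= 2 * N * \I_(x) `|t x - g x|.
  rewrite -RintegralZl//; apply: le_Rintegral => //.
    by have := integrableZl measurable_unit_itv (2 * N) i1; apply: eq_integrable.
  move=> x _; rewrite -real_normK ?num_real// expr2 ler_pM//.
  rewrite (le_trans (ler_normB _ _))// mulr_natl mulr2n lerD//.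
  exact: truncation_bound.
have h3 : 2 * N * \I_(x) `|t x - g x| < e / 4.
  have -> : e / 4 = 2 * N * (e / (8 * N)) by field; rewrite gt_eqF.
  by rewrite ltr_pM2l// mulr_gt0.
apply: (@le_lt_trans _ _ (2 * \I_(x) (f x - t x) ^+ 2 + 2 * \I_(x) (t x - h x) ^+ 2)); last first.
  have sum4 (a b : R) : a < e / 4 -> b < e / 4 -> 2 * a + 2 * b < e by clear; lra.
  exact: sum4 nP (le_lt_trans h2 h3).
have z2 k : intD (fun x => k x ^+ 2) -> intD (fun x => 2 * k x ^+ 2).
  by move=> ik; have := integrableZl measurable_unit_itv 2 ik; apply: eq_integrable.
rewrite -!RintegralZl// -RintegralD//; [|exact: (z2 _ i3)|exact: (z2 _ i2)].
apply: le_Rintegral => //.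
  have := integrableD measurable_unit_itv (z2 _ i3) (z2 _ i2).
  by apply: eq_integrable.
by move=> x _; have := sqr_ge0 (f x - t x - (t x - h x)); nra.
Qed.

Lemma square_integrable_approx_mean0 f (e : R) : square_integrable f -> 0 < e ->
  \I_(x) f x = 0 ->
  exists g (d : R), [/\ continuous g, 0 < d,
    forall x : R, (x < d) || (1 - d < x) -> g x = 0,
    \I_(x) g x = 0 &
    \I_(x) (f x - g x) ^+ 2 < e].
Proof.
move=> Lf e0 f0.
have [b [d [cb d0 bd bP]]] :=
  square_integrable_approx (square_integrable1 (R := R)) (@ltr01 R).
have Lb := continuous_square_integrable cb.
set m := \I_(x) b x.
have m0 : m != 0.
  apply/eqP => m0; have := sqr_Rintegral_le (square_integrableB square_integrable1 Lb).
  rewrite /= RintegralB//; last 2 first.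
    exact: square_integrable_integrable square_integrable1.
    exact: square_integrable_integrable Lb.
  rewrite Rintegral_unit_cst -/m m0; lra.
pose B := \I_(x) b x ^+ 2.
have B0 : 0 <= B by apply: Rintegral_ge0 => x _; exact: sqr_ge0.
pose K := 2 + 2 * B / m ^+ 2.
have K0 : 0 < K by rewrite ltr_wpDr// divr_ge0 ?sqr_ge0// mulr_ge0.
have [g [d' [cg d'0 gd gP]]] := square_integrable_approx Lf (divr_gt0 e0 K0).
have Lg := continuous_square_integrable cg.
set s := \I_(x) g x.
have sP : s ^+ 2 <= \I_(x) (f x - g x) ^+ 2.
  have := sqr_Rintegral_le (square_integrableB Lf Lg).
  rewrite RintegralB//; try exact: square_integrable_integrable.
  by rewrite f0 sub0r sqrrN.
pose h x := g x - s / m * b x.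
have Lh : square_integrable h by exact/square_integrableB/square_integrableZ.
exists h, (Num.min d d'); split.
- move=> x; apply: cvgB; first exact: cg.
  by apply: cvgM; [exact: cvg_cst|exact: cb].
- by rewrite lt_min d0.
- move=> x xd.
  have md : Num.min d d' <= d by rewrite ge_min lexx.
  have md' : Num.min d d' <= d' by rewrite ge_min lexx orbT.
  rewrite /h gd ?bd ?mulr0 ?subr0//; clear -xd md md';
    apply/orP; case/orP: xd => xd; [left|right|left|right]; lra.
- rewrite RintegralB//; last 2 first.
  + exact: square_integrable_integrable.
  + exact/square_integrable_integrable/square_integrableZ.
  rewrite RintegralZl//; last exact: square_integrable_integrable.
  by rewrite -/s -/m divfK// subrr.
apply: (@le_lt_trans _ _ (2 * \I_(x) (f x - g x) ^+ 2 + 2 * (s / m) ^+ 2 * B)).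
  have i1 := square_integrable_sqr (square_integrableB Lf Lg).
  have i2 := square_integrable_sqr Lb.
  have z k r : intD (fun x => k x ^+ 2) -> intD (fun x => r * k x ^+ 2).
    by move=> ik; have := integrableZl measurable_unit_itv r ik; apply: eq_integrable.
  rewrite -!RintegralZl// -RintegralD//; [|exact: (z _ _ i1)|exact: (z _ _ i2)].
  apply: le_Rintegral => //.
    exact/square_integrable_sqr/square_integrableB.
    have := integrableD measurable_unit_itv (z _ 2 i1) (z _ (2 * (s / m) ^+ 2) i2).
    by apply: eq_integrable.
  by move=> x _; rewrite /h; have := sqr_ge0 (f x - g x - s / m * b x); nra.
have -> : 2 * (s / m) ^+ 2 * B = 2 * B / m ^+ 2 * s ^+ 2 by field.
apply: (@le_lt_trans _ _ (K * \I_(x) (f x - g x) ^+ 2)).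
  rewrite /K [leRHS]mulrDl lerD2l ler_wpM2l// divr_ge0 ?sqr_ge0// mulr_ge0//.
by rewrite mulrC -ltr_pdivlMr.
Qed.
End density.

(** * Weak derivatives *)

Section weak_derivatives.
Context {R : realType}.
Implicit Types (f g u v : R -> R) (d e : R).
Local Notation mu := (@lebesgue_measure R).
Local Notation D := (unit_itv R).
Local Notation "\I_ ( x ) f" := (\int[mu]_(x in D) f)%R
  (at level 36, x name, f at level 36).
Local Notation intD f := (mu.-integrable D (EFin \o f)).
Let mD : measurable (D : set (measurableTypeR R)) := @measurable_unit_itv R.
Let mD' : measurable D := @measurable_unit_itv_default R.
Hint Resolve mD mD' : core.

Lemma is_derive_derive1 f g : (forall x : R, is_derive x 1 f (g x)) -> derive1 f = g.
Proof. by move=> fg; apply/funext => x; rewrite derive1E; exact: derive_val. Qed.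

Lemma is_derive_continuous f g : (forall x : R, is_derive x 1 f (g x)) -> continuous f.
Proof. by move=> fg x; apply: differentiable_continuous; apply/derivable1_diffP. Qed.

Lemma continuous_integrable f : continuous f -> intD f.
Proof. by move=> /continuous_square_integrable/square_integrable_integrable. Qed.

Lemma Rintegral_unit_cc f : continuous f ->
  \int[mu]_(x in `[0, 1]) f x = \I_(x) f x.
Proof.
move=> cf; have cf' : {within `[0, 1], continuous f} by exact: continuous_subspaceT.
have i01 := continuous_compact_integrable (@segment_compact R 0 1) cf'.
rewrite -Rintegral_itv_bndo_bndc; last first.
  by apply: integrableS i01 => //; apply: subset_itvl; rewrite bnd_simp.
rewrite -Rintegral_itv_obnd_cbnd//.
exact: continuous_integrable.
Qed.

Lemma Rintegral_is_derive f g : (forall x : R, is_derive x 1 f (g x)) ->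
  continuous g -> \I_(x) g x = f 1 - f 0.
Proof.
move=> fg cg; rewrite -Rintegral_unit_cc// /Rintegral.
have cf := is_derive_continuous fg.
rewrite (@continuous_FTC2 _ g f)//.
- exact: continuous_subspaceT.
- split; first by move=> x _; apply: ex_derive.
  + exact: cvg_at_right_filter (cf 0).
  + exact: cvg_at_left_filter (cf 1).
- by move=> x _; rewrite (is_derive_derive1 fg).
Qed.

Lemma test_function_support f g d : (forall x : R, is_derive x 1 f (g x)) ->
  continuous g -> 0 < d ->
  (forall x : R, (x < d) || (1 - d < x) -> f x = 0) -> test_function f.
Proof.
move=> fg cg d0 fd.
have sub : closure [set x | f x != 0] `<=` `[d, 1 - d].
  rewrite [X in _ `<=` X](_ : _ = closure `[d, 1 - d]%classic); last first.
    by apply/closure_id; exact: itv_closed.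
  apply: closure_subset => x /= fx0; rewrite in_itv/=.
  apply/andP; split; rewrite leNgt; apply: contra fx0 => xd;
    by rewrite fd// xd ?orbT.
split.
- by move=> x; exact: ex_derive.
- by rewrite (is_derive_derive1 fg).
- apply: (subclosed_compact (@closed_closure _ _) (@segment_compact R d (1 - d))).
  exact: sub.
- apply: (subset_trans sub) => x; rewrite /unit_itv /= !in_itv/= => /andP[dx xd].
  by apply/andP; split; lra.
Qed.

Lemma test_function_is_derive f : test_function f ->
  (forall x : R, is_derive x 1 f (derive1 f x)) /\ continuous (derive1 f).
Proof.
by case=> df cf _ _; split=> // x; rewrite derive1E; exact: derivableP.
Qed.

Lemma test_function_continuous f : test_function f -> continuous f.
Proof. by move=> /test_function_is_derive[/is_derive_continuous]. Qed.

Lemma test_function0 f x : test_function f -> ~ D x -> f x = 0.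
Proof.
case=> _ _ _ sub Dx; apply: contrapT => /eqP fx0.
by apply/Dx/sub/subset_closure.
Qed.

Lemma weak_derivativeE u v phi : square_integrable u -> square_integrable v ->
  weak_derivative u v -> test_function phi ->
  \I_(x) (u x * derive1 phi x) = - \I_(x) (v x * phi x).
Proof.
move=> Lu Lv uv tphi; have [_ cd] := test_function_is_derive tphi.
have := uv _ tphi; rewrite !Rintegral_EFin; last 2 first.
- apply: integrable_mul_square_integrable => //.
  exact/continuous_square_integrable/test_function_continuous.
- apply: integrable_mul_square_integrable => //.
  exact/continuous_square_integrable.
by rewrite -EFinN => -[].
Qed.

Lemma is_derive_weak_derivative u v : (forall x : R, is_derive x 1 u (v x)) ->
  continuous v -> weak_derivative u v.
Proof.
move=> uv cv phi tphi; have [dphi cdphi] := test_function_is_derive tphi.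
have cphi := test_function_continuous tphi.
have cu := is_derive_continuous uv.
have i1 : intD (fun x => u x * derive1 phi x).
  by apply: continuous_integrable => x; apply: cvgM; [exact: cu|exact: cdphi].
have i2 : intD (fun x => v x * phi x).
  by apply: continuous_integrable => x; apply: cvgM; [exact: cv|exact: cphi].
rewrite !Rintegral_EFin// -EFinN; congr EFin; apply/eqP.
rewrite -subr_eq0 opprK -RintegralD//.
have dup (x : R) : is_derive x 1 (fun x => u x * phi x) (u x * derive1 phi x + v x * phi x).
  by apply: is_derive_eq; rewrite /GRing.scale/=; ring.
rewrite (Rintegral_is_derive dup).
  by rewrite (@test_function0 phi 1)// ?(@test_function0 phi 0)// ?mulr0 ?subrr//;
    rewrite /unit_itv /= in_itv/= ?ltxx ?andbF.
by move=> x; apply: cvgD; apply: cvgM; [exact: cu|exact: cdphi|exact: cv|exact: cphi].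
Qed.

Lemma exists_primitive g d : continuous g -> 0 < d ->
  (forall x : R, (x < d) || (1 - d < x) -> g x = 0) ->
  exists G : R -> R, [/\ forall x : R, is_derive x 1 G (g x),
    forall x : R, x < d -> G x = 0 & forall x : R, 1 - d < x -> G x = \I_(y) g y].
Proof.
move=> cg d0 gd; pose G x := \int[mu]_(y in `[0, x]) g y.
have Gd x : x < d -> G x = 0.
  move=> xd; rewrite /G (@eq_Rintegral _ _ _ _ _ (cst 0)).
    by rewrite Rintegral_cst// mul0r.
  move=> y; rewrite inE/= in_itv/= => /andP[_ yx].
  by rewrite gd// (le_lt_trans yx).
have dG (x : R) : is_derive x 1 G (g x).
  have [xd|dx] := ltP x d.
    rewrite gd ?xd//; apply: (near_eq_is_derive (f := cst 0)).
    - by near=> y; rewrite Gd//; near: y; exact: lt_nbhsl.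
  have x0 : 0 < x by exact: lt_le_trans dx.
  have xu : x < x + 1 by rewrite ltrDl.
  have ig := continuous_compact_integrable (@segment_compact R 0 (x + 1))
    (continuous_subspaceT cg).
  have [dGx <-] := continuous_FTC1_closed xu ig x0 (cg x).
  by rewrite derive1E; exact: derivableP.
exists G; split=> // x dx; have <- : G 1 = \I_(y) g y by exact: Rintegral_unit_cc.
have cG (A : set R) : {within A, continuous G}.
  by apply: continuous_subspaceT; exact: is_derive_continuous dG.
apply/eqP; rewrite -subr_eq0; have [x1|x1] := leP x 1.
  have [c] := MVT_segment x1 (fun y _ => dG y) (cG _).
  rewrite in_itv/= => /andP[xc c1] h; rewrite -opprB h gd ?mul0r ?oppr0//.
  by rewrite (lt_le_trans dx xc) orbT.
have [c] := MVT_segment (ltW x1) (fun y _ => dG y) (cG _).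
rewrite in_itv/= => /andP[xc c1] ->; rewrite gd ?mul0r//.
by apply/orP; right; lra.
Unshelve. all: by end_near. Qed.

Lemma Rintegral_cvg f g (s : nat -> R -> R) : intD g ->
  (forall n, measurable_fun D (s n)) -> measurable_fun D f ->
  (forall n x, D x -> `|s n x| <= g x) ->
  (forall x, D x -> s n x @[n --> \oo] --> f x) ->
  \I_(x) s n x @[n --> \oo] --> \I_(x) f x.
Proof.
move=> ig ms mf sg sf.
have [| | | | |fi _ h] := @dominated_convergence _ _ _ mu D mD
  (fun n x => (s n x)%:E) (EFin \o f) (EFin \o g).
- by move=> n; apply/measurable_EFinP; exact: ms.
- exact/measurable_EFinP.
- apply: aeW => x Dx; apply: cvg_EFin; last exact: sf.
  by near=> n.
- exact: ig.
- by apply: aeW => x n Dx; rewrite /= lee_fin sg.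
have -> : \I_(x) f x = fine (\int[mu]_(x in D) (f x)%:E)%E by [].
by apply: fine_cvg; rewrite fineK//; exact: integrable_fin_num.
Unshelve. all: by end_near. Qed.

Lemma orthogonal_test_continuous w g d : square_integrable w ->
  (forall phi, test_function phi -> \I_(x) (w x * phi x) = 0) ->
  continuous g -> 0 < d ->
  (forall x : R, (x < d) || (1 - d < x) -> g x = 0) ->
  \I_(x) (w x * g x) = 0.
Proof.
move=> Lw w0 cg d0 gd; have [G [dG Gl Gr]] := exists_primitive cg d0 gd.
have [M M0 gM'] := continuous_unit_bounded cg.
have gM (x : R) : `|g x| <= M.
  have [xd|dx] := boolP ((x < d) || (1 - d < x)); first by rewrite gd// normr0.
  apply: gM'; move: dx; rewrite negb_or -!leNgt => /andP[dx xd].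
  by rewrite /unit_itv /= in_itv/=; apply/andP; split; lra.
pose e n : R := d / 2 / n.+1%:R.
have e0 n : 0 < e n by rewrite !divr_gt0.
have ed n : e n <= d / 2.
  rewrite /e ler_pdivrMr// ler_peMr ?ler1n//; lra.
pose s n x := (e n)^-1 * (G (x + e n) - G x).
have ds n (x : R) : is_derive x 1 (s n) ((e n)^-1 * (g (x + e n) - g x)).
  have h : is_derive x 1 (G \o shift (e n)) (g (x + e n) * 1).
    exact: (@is_derive1_comp _ G (shift (e n)) x _ _ (dG (x + e n)) (is_derive_shift _ _ _)).
  have hs := is_deriveZ (e n)^-1 (is_deriveB h (dG x)).
  by rewrite mulr1 in hs.
have ts n : test_function (s n).
  apply: (@test_function_support _ (fun x => (e n)^-1 * (g (x + e n) - g x)) (d / 2)).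
  - move=> x; apply: cvgM; first exact: cvg_cst.
    apply: cvgB; last exact: cg.
    apply: (@continuous_comp _ _ _ (fun y => y + e n) g); last exact: cg.
    by apply: cvgD; [exact: cvg_id|exact: cvg_cst].
  - by rewrite divr_gt0.
  - have := ed n; have := e0 n => en0 end2 x /orP[xd|xd]; rewrite /s.
    + by rewrite !Gl ?subrr ?mulr0//; lra.
    + by rewrite !Gr ?subrr ?mulr0//; lra.
have sP n (x : R) : exists2 c, x < c < x + e n & s n x = g c.
  have xe : x < x + e n by rewrite ltrDl.
  have [c cx h] := MVT xe (fun y _ => dG y)
    (continuous_subspaceT (is_derive_continuous dG)).
  exists c; first by move: cx; rewrite in_itv.
  by rewrite /s h addrAC subrr add0r mulrC mulfK ?gt_eqF.
have e_cvg : e n @[n --> \oo] --> 0.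
  have -> : 0 = d / 2 * 0 by rewrite mulr0.
  by apply: cvgM; [exact: cvg_cst|exact: cvg_harmonic].
have s_cvg (x : R) : s n x @[n --> \oo] --> g x.
  apply/cvgrPdist_lt => r r0.
  have /cvgrPdist_lt/(_ r r0)/nbhs_ballP[a a0 ga] := cg x.
  near=> n; have [c /andP[xc cx] ->] := sP n x.
  have ea : e n < a.
    rewrite -[e n]gtr0_norm// -[e n]subr0 distrC.
    by near: n; move/cvgrPdist_lt : e_cvg; apply.
  by apply: ga; rewrite /ball /= ltr_norml; apply/andP; split; lra.
have : \I_(x) (w x * s n x) @[n --> \oo] --> \I_(x) (w x * g x).
  have mw : measurable_fun D w by case: Lw.
  apply: (@Rintegral_cvg _ (fun x => M * `|w x|)).
  - have := integrableZl mD M (integrable_norm (square_integrable_integrable Lw)).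
    by apply: eq_integrable.
  - move=> n; apply: measurable_funM => //.
    by apply: continuous_measurable_unit; exact: test_function_continuous.
  - by apply: measurable_funM => //; exact: continuous_measurable_unit.
  - by move=> n x _; rewrite normrM mulrC ler_wpM2r//; have [c _ ->] := sP n x.
  - by move=> x _; apply: cvgM; [exact: cvg_cst|exact: s_cvg].
under eq_fun do rewrite w0//.
by move=> /cvg_unique; apply => //; exact: cvg_cst.
Unshelve. all: by end_near. Qed.

Lemma orthogonal_test_ae0 w : square_integrable w ->
  (forall phi, test_function phi -> \I_(x) (w x * phi x) = 0) ->
  ae_equal w (cst 0).
Proof.
move=> Lw w0; have iw := square_integrable_sqr Lw.
have I0 : \I_(x) w x ^+ 2 = 0.
  apply/eqP; rewrite eq_le Rintegral_ge0 ?andbT; last by move=> x _; exact: sqr_ge0.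
  apply/ler_addgt0Pl => r r0; rewrite addr0.
  have [g [d [cg d0 gd gP]]] := square_integrable_approx Lw r0.
  have Lg := continuous_square_integrable cg.
  have iwg := integrable_mul_square_integrable Lw Lg.
  have i2wg : intD (fun x => 2 * (w x * g x)).
    by have := integrableZl mD 2 iwg; apply: eq_integrable.
  have wg0 := orthogonal_test_continuous Lw w0 cg d0 gd.
  apply: (le_trans _ (ltW gP)).
  have -> : \I_(x) (w x - g x) ^+ 2 = \I_(x) (w x ^+ 2 - 2 * (w x * g x) + g x ^+ 2).
    by apply: eq_Rintegral => x _; ring.
  have ig := square_integrable_sqr Lg.
  rewrite RintegralD//; last first.
    by have := integrableB mD iw i2wg; apply: eq_integrable.
  rewrite RintegralB// RintegralZl// wg0 mulr0 subr0 lerDl.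
  by apply: Rintegral_ge0 => x _; exact: sqr_ge0.
have mw : measurable_fun D (fun x => (w x ^+ 2)%:E).
  by apply/measurable_EFinP; apply: measurable_funX; case: Lw.
have /(ae_eq_integral_abs mu mD mw) : (\int[mu]_(x in D) `|(w x ^+ 2)%:E| = 0)%E.
  under eq_integral do rewrite /= ger0_norm ?sqr_ge0//.
  by rewrite Rintegral_EFin// I0.
apply: filterS => x /[apply] -[] /eqP.
by rewrite sqrf_eq0 => /eqP.
Qed.

Lemma weak_derivative_unique u v w : square_integrable u ->
  square_integrable v -> square_integrable w ->
  weak_derivative u v -> weak_derivative u w -> ae_equal v w.
Proof.
move=> Lu Lv Lw uv uw.
have /orthogonal_test_ae0 : square_integrable (fun x => v x - w x).
  exact: square_integrableB.
have vw0 phi : test_function phi -> \I_(x) ((v x - w x) * phi x) = 0.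
  move=> tphi; have Lphi := continuous_square_integrable (test_function_continuous tphi).
  under eq_Rintegral do rewrite mulrBl.
  rewrite RintegralB//; try exact: integrable_mul_square_integrable.
  apply/eqP; rewrite subr_eq0 -eqr_opp.
  by rewrite -!(@weak_derivativeE u)//.
move=> /(_ vw0); apply: filterS => x /[apply] /eqP.
by rewrite subr_eq0 => /eqP.
Qed.

Lemma ae_equal_Rintegral f g : intD f -> intD g -> ae_equal f g ->
  \I_(x) f x = \I_(x) g x.
Proof.
move=> fi gi fg; congr fine; apply: ae_eq_integral => //.
- exact: measurable_int fi.
- exact: measurable_int gi.
- by apply: filterS fg => x /[apply] ->.
Qed.
End weak_derivatives.

(** * First eigenvalue from a monotone eigenfunction *)

Section certificate.
Context {R : realType}.
Implicit Types (f g u v : R -> R) (d e : R).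
Local Notation mu := (@lebesgue_measure R).
Local Notation D := (unit_itv R).
Local Notation "\I_ ( x ) f" := (\int[mu]_(x in D) f)%R
  (at level 36, x name, f at level 36).
Local Notation intD f := (mu.-integrable D (EFin \o f)).
Let mD : measurable (D : set (measurableTypeR R)) := @measurable_unit_itv R.
Let mD' : measurable D := @measurable_unit_itv_default R.
Hint Resolve mD mD' : core.

Lemma ae_equal0_exists f : ae_equal f (cst 0) -> exists2 x, D x & f x = 0.
Proof.
move=> [N [mN N0 DN]]; apply: contrapT => nex.
have DsubN : D `<=` N.
  by move=> x Dx; apply: DN => /(_ Dx) fx0; apply: nex; exists x.
have := le_measure mu (mem_set mD) (mem_set mN) DsubN.
have := measure_unit_itv (R := R); rewrite /= => -> /=.
by rewrite N0 lee_fin ler10.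
Qed.

(* [G] is the flux [h y'] of an eigenfunction [y] with Neumann conditions. *)
Variables (h y G : R -> R) (l : R).
Hypotheses (l0 : 0 < l) (ch : continuous h) (h0 : forall x, 0 < h x).
Hypotheses (dy : forall x : R, is_derive x 1 y (G x / h x)).
Hypotheses (dG : forall x : R, is_derive x 1 G (- (l * h x * y x))).
Hypotheses (G0 : G 0 = 0) (G1 : G 1 = 0) (Gneg : forall x, D x -> G x < 0).

Let hn0 x : h x != 0. Proof. by rewrite gt_eqF. Qed.
Let cy : continuous y := is_derive_continuous dy.
Let cG : continuous G := is_derive_continuous dG.
Let chV : continuous (fun x => (h x)^-1).
Proof. by move=> x; apply: cvgV => //; exact: ch. Qed.
Let cGh : continuous (fun x => G x / h x).
Proof. by move=> x; apply: cvgM; [exact: cG|exact: chV]. Qed.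

Lemma integrable_sqr_weight u k : square_integrable u -> continuous k ->
  intD (fun x => u x ^+ 2 * k x).
Proof.
move=> Lu ck; have := integrable_mul_square_integrable Lu (square_integrableMr Lu ck).
by apply: eq_integrable => //= x _; congr EFin; ring.
Qed.

Lemma Rintegral_sqr_weight u g c : square_integrable u -> square_integrable g ->
  \I_(x) ((u x * h x + c * g x) ^+ 2 / h x) =
  \I_(x) (u x ^+ 2 * h x) + 2 * c * \I_(x) (u x * g x)
    + c ^+ 2 * \I_(x) (g x ^+ 2 / h x).
Proof.
move=> Lu Lg.
have i1 := integrable_sqr_weight Lu ch.
have i2 := integrable_mul_square_integrable Lu Lg.
have i3 := integrable_sqr_weight Lg chV.
have i2' : intD (fun x => 2 * c * (u x * g x)).
  by have := integrableZl mD (2 * c) i2; apply: eq_integrable.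
have i3' : intD (fun x => c ^+ 2 * (g x ^+ 2 / h x)).
  by have := integrableZl mD (c ^+ 2) i3; apply: eq_integrable.
have i12 : intD (fun x => u x ^+ 2 * h x + 2 * c * (u x * g x)).
  by have := integrableD mD i1 i2'; apply: eq_integrable.
rewrite -!RintegralZl// -!RintegralD//.
by apply: eq_Rintegral => x _; field.
Qed.

Lemma dual_wirtinger P g d : continuous g -> 0 < d ->
  (forall x : R, is_derive x 1 P (g x)) ->
  (forall x : R, (x < d) || (1 - d < x) -> P x = 0) ->
  l * \I_(x) (P x ^+ 2 / h x) <= \I_(x) (g x ^+ 2 / h x).
Proof.
move=> cg d0 dP Pd; have cP := is_derive_continuous dP.
have inD x : ~~ ((x < d) || (1 - d < x)) -> G x != 0.
  rewrite negb_or -!leNgt => /andP[dx xd]; rewrite lt_eqF// Gneg//.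
  by rewrite /unit_itv /= in_itv/=; apply/andP; split; lra.
have Pnear x : (x < d) || (1 - d < x) -> \forall t \near x, P t = 0.
  case/orP => xd; near=> t; apply: Pd; apply/orP; [left|right]; near: t.
  - exact: lt_nbhsl.
  - exact: lt_nbhsr.
(* [q] solves the Riccati equation q' = - l / h - h q^2. *)
pose q x := - (l * y x / G x).
pose p x := P x * q x.
have cp : continuous p.
  move=> x; have [xd|xd] := boolP ((x < d) || (1 - d < x)).
    rewrite /continuous_at {2}/p Pd// mul0r; apply: cvg_near_cst.
    by apply: filterS (Pnear x xd) => t Pt; rewrite /p Pt mul0r.
  apply: cvgM; first exact: cP.
  apply: cvgN; apply: cvgM; last by apply: cvgV; [exact: inD|exact: cG].
  by apply: cvgM; [exact: cvg_cst|exact: cy].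
pose f x := 2 * g x * p x - l * (P x ^+ 2 / h x) - h x * p x ^+ 2.
have cf : continuous f.
  move=> x; have c2 (k : R -> R) : continuous k -> {for x, continuous (fun x => k x ^+ 2)}.
    by move=> ck; apply: (@cvgM _ _ _ _ k k); exact: ck.
  apply: cvgB; last by apply: cvgM; [exact: ch|exact: c2].
  apply: cvgB.
    by apply: cvgM; [apply: cvgM; [exact: cvg_cst|exact: cg]|exact: cp].
  by apply: cvgM; [exact: cvg_cst|apply: cvgM; [exact: c2|exact: chV]].
have dQ (x : R) : is_derive x 1 (fun x => P x ^+ 2 * q x) (f x).
  have [xd|xd] := boolP ((x < d) || (1 - d < x)).
    have -> : f x = 0 by rewrite /f /p Pd//; ring.
    apply: (near_eq_is_derive (f := cst 0)).
    by apply: filterS (Pnear x xd) => t /= ->; rewrite expr0n mul0r.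
  have Gx := inD _ xd.
  apply: is_derive_eq; rewrite /GRing.scale/= /f /p /q; field.
  by rewrite Gx hn0.
have i1 := integrable_sqr_weight (continuous_square_integrable cg) chV.
have i2 := integrable_sqr_weight (continuous_square_integrable cP) chV.
have i2' : intD (fun x => l * (P x ^+ 2 / h x)).
  by have := integrableZl mD l i2; apply: eq_integrable.
have If : \I_(x) f x = 0.
  by rewrite (Rintegral_is_derive dQ cf) !Pd ?expr0n ?mul0r ?subr0//;
    apply/orP; [left|right]; lra.
rewrite -RintegralZl// -subr_ge0 -RintegralB// -If; apply: le_Rintegral => //.
- exact: continuous_integrable.
- by have := integrableB mD i1 i2'; apply: eq_integrable.
- move=> x _; rewrite /f -subr_ge0.
  have -> : g x ^+ 2 / h x - l * (P x ^+ 2 / h x)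
      - (2 * g x * p x - l * (P x ^+ 2 / h x) - h x * p x ^+ 2)
    = (g x - h x * p x) ^+ 2 / h x by field.
  by rewrite divr_ge0 ?sqr_ge0 ?ltW.
Unshelve. all: by end_near. Qed.

Lemma weighted_poincare u v : square_integrable u -> square_integrable v ->
  weak_derivative u v -> \I_(x) (u x * h x) = 0 ->
  l * \I_(x) (u x ^+ 2 * h x) <= \I_(x) (v x ^+ 2 * h x).
Proof.
move=> Lu Lv uv uh0.
have Luh : square_integrable (fun x => u x * h x).
  by have := square_integrableMr Lu ch; under eq_fun do rewrite mulrC.
have [K K0 hK] := continuous_unit_bounded chV.
apply/ler_addgt0Pl => e e0.
have lK : 0 < l * (K + 1) by rewrite mulr_gt0// ltr_wpDl.
have [g [d [cg d0 gd g0 gP]]] :=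
  square_integrable_approx_mean0 Luh (divr_gt0 e0 lK) uh0.
have [P [dP Pl Pr]] := exists_primitive cg d0 gd; rewrite g0 in Pr.
have Pd (x : R) : (x < d) || (1 - d < x) -> P x = 0.
  by case/orP; [exact: Pl|exact: Pr].
have tP := test_function_support dP cg d0 Pd.
have Lg := continuous_square_integrable cg.
have LP := continuous_square_integrable (test_function_continuous tP).
have := weak_derivativeE Lu Lv uv tP; rewrite (is_derive_derive1 dP) => ug.
have PW := dual_wirtinger cg d0 dP Pd.
have := Rintegral_sqr_weight l Lv LP; set A := \I_(x) _ => AE.
have A0 : 0 <= A.
  by apply: Rintegral_ge0 => x _; rewrite divr_ge0 ?sqr_ge0 ?ltW.
have := Rintegral_sqr_weight (-1) Lu Lg; set B := \I_(x) _ => BE.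
have Be : B <= e / l.
  have i1 := square_integrable_sqr (square_integrableB Luh Lg).
  have i1' : intD (fun x => (K + 1) * (u x * h x - g x) ^+ 2).
    by have := integrableZl mD (K + 1) i1; apply: eq_integrable.
  apply: (@le_trans _ _ ((K + 1) * \I_(x) (u x * h x - g x) ^+ 2)).
    rewrite -RintegralZl//; apply: le_Rintegral => //.
      have := integrable_sqr_weight (square_integrableB Luh Lg) chV.
      by apply: eq_integrable => //= x _; rewrite mulN1r.
    move=> x Dx; rewrite mulN1r mulrC ler_wpM2r ?sqr_ge0//.
    by rewrite (le_trans (ler_norm _))// (le_trans (hK x Dx))// lerDl.
  rewrite -ler_pdivlMl; last by rewrite ltr_wpDl.
  by rewrite (le_trans (ltW gP))// invfM [leLHS]mulrA [leLHS]mulrC.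
have lB : l * B <= e by rewrite mulrC -ler_pdivlMr.
clear Be; move: AE BE lB PW A0 ug.
move: (A) (B) (\I_(x) (u x ^+ 2 * h x)) (\I_(x) (v x ^+ 2 * h x))
  (\I_(x) (u x * g x)) (\I_(x) (v x * P x)) (\I_(x) (g x ^+ 2 / h x))
  (\I_(x) (P x ^+ 2 / h x)) => {}A {}B U V uG vP gg PP.
clear -l0 => AE BE lB PW A0 ugE.
have h1 : l * (l * PP) <= l * gg by rewrite ler_pM2l.
have h2 : V = A - 2 * l * vP - l * (l * PP) by rewrite AE; ring.
have h3 : l * U = l * B - 2 * l * vP - l * gg by rewrite BE ugE; ring.
lra.
Qed.

Lemma Rintegral_sqr_weight_gt0 u : square_integrable u ->
  ~ ae_equal u (cst 0) -> 0 < \I_(x) (u x ^+ 2 * h x).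
Proof.
move=> Lu; apply: contra_notT; rewrite -leNgt => uh_le0.
have uh0 x : 0 <= u x ^+ 2 * h x by rewrite mulr_ge0 ?sqr_ge0 ?ltW.
have iu := integrable_sqr_weight Lu ch.
have mw : measurable_fun D (fun x => (u x ^+ 2 * h x)%:E) by exact: measurable_int iu.
have /(ae_eq_integral_abs mu mD mw) : (\int[mu]_(x in D) `|(u x ^+ 2 * h x)%:E| = 0)%E.
  under eq_integral do rewrite /= ger0_norm ?uh0//.
  rewrite Rintegral_EFin//; congr EFin; apply/eqP.
  by rewrite eq_le uh_le0 Rintegral_ge0.
apply: filterS => x /[apply] -[] /eqP.
by rewrite mulf_eq0 (negbTE (hn0 x)) orbF sqrf_eq0 => /eqP.
Qed.

Lemma rayleighP u v q : square_integrable u -> square_integrable v ->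
  ~ ae_equal u (cst 0) ->
  q = ((\int[mu]_(x in D) (v x ^+ 2 * h x)%:E) /
       (\int[mu]_(x in D) (u x ^+ 2 * h x)%:E))%E ->
  q = (\I_(x) (v x ^+ 2 * h x) / \I_(x) (u x ^+ 2 * h x))%:E.
Proof.
move=> Lu Lv /(Rintegral_sqr_weight_gt0 Lu) B0 ->.
by rewrite !Rintegral_EFin ?inver ?gt_eqF//; exact: integrable_sqr_weight.
Qed.

Lemma le_mu_1 : (l%:E <= mu_ 1 h)%E.
Proof.
apply: le_ereal_inf_tmp => _ [E [[EH [b [bi EE]]] Eh0 ->]]; subst E.
pose u := lin_comb b (fun=> 1).
have Eu : range (lin_comb b) u by exists (fun=> 1).
have u0 : ~ ae_equal u (cst 0).
  by move=> /bi/(_ ord0)/eqP; rewrite oner_eq0.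
have [Lu [v Lv uv]] := EH _ Eu.
have iuh : intD (fun x => u x * h x).
  apply: square_integrable_integrable.
  by have := square_integrableMr Lu ch; under eq_fun do rewrite mulrC.
have := Eh0 _ Eu; rewrite Rintegral_EFin// => -[uh0].
pose q := ((\int[mu]_(x in D) (v x ^+ 2 * h x)%:E) /
           (\int[mu]_(x in D) (u x ^+ 2 * h x)%:E))%E.
apply: (@le_trans _ _ q); last first.
  by apply: ereal_sup_ubound; exists u; split=> //; exists v.
rewrite (rayleighP Lu Lv u0 (erefl q)) lee_fin ler_pdivlMr.
  exact: weighted_poincare.
exact: Rintegral_sqr_weight_gt0.
Qed.

Lemma Rintegral_eigenfunction : \I_(x) (y x * h x) = 0.
Proof.
have cw : continuous (fun x => - (l * h x * y x)).
  move=> x; apply: cvgN; apply: cvgM; last exact: cy.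
  by apply: cvgM; [exact: cvg_cst|exact: ch].
have := Rintegral_is_derive dG cw; rewrite G0 G1 subrr.
have -> : \I_(x) (- (l * h x * y x)) = - l * \I_(x) (y x * h x).
  rewrite -RintegralZl//; first by apply: eq_Rintegral => x _; ring.
  by apply: continuous_integrable => x; apply: cvgM; [exact: cy|exact: ch].
by move/eqP; rewrite mulf_eq0 oppr_eq0 gt_eqF//= => /eqP.
Qed.

Lemma rayleigh_eigenfunction :
  \I_(x) ((G x / h x) ^+ 2 * h x) = l * \I_(x) (y x ^+ 2 * h x).
Proof.
have Ly := continuous_square_integrable cy.
have LGh := continuous_square_integrable cGh.
have i1 := integrable_sqr_weight LGh ch.
have i2 := integrable_sqr_weight Ly ch.
have i2' : intD (fun x => l * (y x ^+ 2 * h x)).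
  by have := integrableZl mD l i2; apply: eq_integrable.
have dGy (x : R) : is_derive x 1 (fun x => G x * y x)
    ((G x / h x) ^+ 2 * h x - l * (y x ^+ 2 * h x)).
  by apply: is_derive_eq; rewrite /GRing.scale/=; field.
have cf : continuous (fun x => (G x / h x) ^+ 2 * h x - l * (y x ^+ 2 * h x)).
  have c2 (k : R -> R) : continuous k -> continuous (fun x => k x ^+ 2).
    by move=> ck x; apply: (@cvgM _ _ _ _ k k); exact: ck.
  move=> x; apply: cvgB; first by apply: cvgM; [exact: (c2 _ cGh)|exact: ch].
  apply: cvgM; first exact: cvg_cst.
  by apply: cvgM; [exact: (c2 _ cy)|exact: ch].
have := Rintegral_is_derive dGy cf; rewrite G0 G1 !mul0r subrr RintegralB//.
by rewrite RintegralZl// => /eqP; rewrite subr_eq0 => /eqP.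
Qed.

Lemma eigenfunction_not_ae0 : ~ ae_equal y (cst 0).
Proof.
move=> y0; have Ly := continuous_square_integrable cy.
have LGh := continuous_square_integrable cGh.
have : ~ ae_equal (fun x => G x / h x) (cst 0).
  move=> /ae_equal0_exists[x /Gneg Gx] /eqP.
  by rewrite mulf_eq0 invr_eq0 (negbTE (hn0 x)) orbF lt_eqF.
move=> /(Rintegral_sqr_weight_gt0 LGh); rewrite rayleigh_eigenfunction.
rewrite (@ae_equal_Rintegral _ _ (cst 0)).
- by rewrite Rintegral_cst// mul0r mulr0 ltxx.
- exact: integrable_sqr_weight.
- by apply: continuous_integrable => x; exact: cvg_cst.
- by apply: filterS y0 => x /[apply] ->; rewrite expr0n mul0r.
Qed.

Lemma mu_1_le : (mu_ 1 h <= l%:E)%E.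
Proof.
have Ly := continuous_square_integrable cy.
have LGh := continuous_square_integrable cGh.
have dcy c (x : R) : is_derive x 1 (fun x => c * y x) (c * (G x / h x)).
  exact: is_deriveZ.
have wcy c : weak_derivative (fun x => c * y x) (fun x => c * (G x / h x)).
  apply: is_derive_weak_derivative (dcy c) _ => x.
  by apply: cvgM; [exact: cvg_cst|exact: cGh].
pose b (i : 'I_1) := y.
have bE (c : 'I_1 -> R) : lin_comb b c = (fun x => c ord0 * y x).
  by apply/funext => x; rewrite /lin_comb big_ord1.
apply: le_trans (ereal_inf_lbound _) _.
  exists (range (lin_comb b)); split=> //; first split.
  - move=> _ [c _ <-]; rewrite bE; split; first exact: square_integrableZ.
    by exists (fun x => c ord0 * (G x / h x)) => //; exact: square_integrableZ.
  - exists b; split=> // c; rewrite bE => cy0 i; rewrite (ord1 i).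
    apply: contrapT => /eqP c0; apply: eigenfunction_not_ae0.
    apply: filterS cy0 => x /[apply] /eqP.
    by rewrite mulf_eq0 (negbTE c0) => /eqP.
  - move=> _ [c _ <-]; rewrite bE.
    have iyh : intD (fun x => y x * h x).
      by apply: continuous_integrable => x; apply: cvgM; [exact: cy|exact: ch].
    have -> : (\int[mu]_(x in D) (c ord0 * y x * h x)%:E =
               \int[mu]_(x in D) ((c ord0)%:E * (y x * h x)%:E))%E.
      by apply: eq_integral => x _; rewrite -mulrA.
    by rewrite integralZl// Rintegral_EFin// Rintegral_eigenfunction mule0.
apply: ge_ereal_sup => q [_ [[c _ <-]]]; rewrite bE => u0 [v [Lv uv qE]].
have Lu := square_integrableZ (c ord0) Ly.
rewrite (rayleighP Lu Lv u0 qE) lee_fin ler_pdivrMr; last first.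
  exact: Rintegral_sqr_weight_gt0.
have Lw := square_integrableZ (c ord0) LGh.
have vw := weak_derivative_unique Lu Lv Lw uv (wcy _).
rewrite (@ae_equal_Rintegral _ _ (fun x => (c ord0 * (G x / h x)) ^+ 2 * h x));
  try exact: integrable_sqr_weight; last by apply: filterS vw => x /[apply] ->.
have cE k : square_integrable k ->
    \I_(x) ((c ord0 * k x) ^+ 2 * h x) = c ord0 ^+ 2 * \I_(x) (k x ^+ 2 * h x).
  move=> Lk; rewrite -RintegralZl//; last exact: integrable_sqr_weight.
  by apply: eq_Rintegral => x _; rewrite exprMn mulrA.
by rewrite !cE// rayleigh_eigenfunction mulrCA.
Qed.

Lemma mu_1_eigenvalue : mu_ 1 h = l%:E.
Proof. by apply/eqP; rewrite eq_le mu_1_le le_mu_1. Qed.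

End certificate.

(** * The weights g_a *)

Section splice.
Context {R : realType}.
Implicit Types (f g k : R -> R) (c x : R).

Definition splice c f g x := if x < c then f x else g x.

Lemma spliceP c f g x : splice c f g x = f x \/ splice c f g x = g x.
Proof. by rewrite /splice; case: ifP; [left|right]. Qed.

Lemma splice_near_l c f g x : x < c -> \forall t \near x, f t = splice c f g t.
Proof.
by move=> xc; apply: filterS (lt_nbhsl xc) => t tc; rewrite /splice tc.
Qed.

Lemma splice_near_r c f g x : c < x -> \forall t \near x, g t = splice c f g t.
Proof.
move=> cx; apply: filterS (lt_nbhsr cx) => t ct.
by rewrite /splice ltNge ltW.
Qed.

Lemma is_derive_cvg f x d : is_derive x 1 f d ->
  (t^-1 *: (f (t *: 1 + x) - f x)) @[t --> 0^'] --> d.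
Proof. by move=> fd; rewrite -(@derive_val _ _ _ _ _ _ _ fd); exact: ex_derive. Qed.

Lemma cvg_either (T : Type) (F : set_system T) {FF : Filter F} (f g k : T -> R) (l : R) :
  f @ F --> l -> g @ F --> l -> (forall t, k t = f t \/ k t = g t) -> k @ F --> l.
Proof.
move=> /cvgrPdist_lt fl /cvgrPdist_lt gl kfg; apply/cvgrPdist_lt => e e0.
apply: filterS2 (fl e e0) (gl e e0) => t ft gt.
by case: (kfg t) => ->.
Qed.

Lemma is_derive_splice c f g f' g' :
  (forall x : R, is_derive x 1 f (f' x)) -> (forall x : R, is_derive x 1 g (g' x)) ->
  f c = g c -> f' c = g' c ->
  forall x : R, is_derive x 1 (splice c f g) (splice c f' g' x).
Proof.
move=> df dg fgc fgc' x; have [xc|cx|->] := ltgtP x c.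
- by rewrite {2}/splice xc; exact: near_eq_is_derive (splice_near_l _ _ xc) (df x).
- rewrite {2}/splice ltNge (ltW cx)/=.
  exact: near_eq_is_derive (splice_near_r _ _ cx) (dg x).
have cvg_splice : (t^-1 *: (splice c f g (t *: 1 + c) - splice c f g c)) @[t --> 0^']
    --> splice c f' g' c.
  apply: (@cvg_either _ _ _ (fun t => t^-1 *: (f (t *: 1 + c) - f c))
    (fun t => t^-1 *: (g (t *: 1 + c) - g c))).
  - by rewrite /splice ltxx -fgc'; exact: is_derive_cvg.
  - by rewrite /splice ltxx; exact: is_derive_cvg.
  - move=> t; have -> : splice c f g c = g c by rewrite /splice ltxx.
    by have [->|->] := spliceP c f g (t *: 1 + c); [left; rewrite fgc|right].
by apply: DeriveDef; [exact/cvgP/cvg_splice|exact/cvg_lim].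
Qed.

Lemma continuous_splice c f g : continuous f -> continuous g -> f c = g c ->
  continuous (splice c f g).
Proof.
move=> cf cg fgc x; have [xc|cx|->] := ltgtP x c.
- rewrite /continuous_at {2}/splice xc.
  by apply: cvg_trans (cf x); exact: near_eq_cvg (splice_near_l _ _ xc).
- rewrite /continuous_at {2}/splice ltNge (ltW cx)/=.
  by apply: cvg_trans (cg x); exact: near_eq_cvg (splice_near_r _ _ cx).
rewrite /continuous_at {2}/splice ltxx.
by apply: (cvg_either _ (cg c) (spliceP c f g)); rewrite -fgc; exact: cf.
Qed.

End splice.

Section first_root.
Context {R : realType}.
Implicit Types a x w : R.

Lemma root_eqE a x : 0 < a -> 0 < x -> cos (x * (2^-1 - a)) != 0 ->
  root_eq a x <->
  sin (x * (2^-1 - a)) * (a * x) = cos (x * (2^-1 - a)) * (1 + a * x).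
Proof.
move=> a0 x0 c0; rewrite /root_eq /tan.
have ax : a * x != 0 by rewrite mulf_neq0// gt_eqF.
have [a0' x0'] : a != 0 /\ x != 0 by rewrite !gt_eqF.
split=> [h|h].
  rewrite -[sin _](divfK c0) h; field.
  by rewrite x0' a0'.
apply: (mulIf c0); rewrite divfK//; apply: (mulIf ax); rewrite h; field.
by rewrite x0' a0'.
Qed.

Lemma first_positive_root_exists a : 0 < a -> a < 2^-1 ->
  exists2 w, first_positive_root a w & w * (2^-1 - a) < pi / 2.
Proof.
move=> a0 a2; set b := 2^-1 - a; have b0 : 0 < b by rewrite subr_gt0.
have pi0 := pi_gt0 R; have p2 : 0 < (pi : R) / 2 by rewrite divr_gt0.
pose F x := sin (x * b) * (a * x) - cos (x * b) * (1 + a * x).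
have cF : continuous F.
  have cb : continuous (fun x => x * b).
    by move=> x; apply: cvgM; [exact: cvg_id|exact: cvg_cst].
  have ca : continuous (fun x => a * x).
    by move=> x; apply: cvgM; [exact: cvg_cst|exact: cvg_id].
  move=> x; apply: cvgB; apply: cvgM.
  - by apply: (continuous_comp (cb x)); exact: continuous_sin.
  - exact: ca.
  - by apply: (continuous_comp (cb x)); exact: continuous_cos.
  - by apply: cvgD; [exact: cvg_cst|exact: ca].
set c := pi / 2 / b; have c0 : 0 < c by rewrite divr_gt0.
have F0 : F 0 = -1 by rewrite /F !mul0r mulr0 sin0 cos0 mul0r; ring.
have Fc : F c = a * c by rewrite /F /c divfK ?gt_eqF// sin_pihalf cos_pihalf; ring.
have ac : 0 < a * c by exact: mulr_gt0.
have [||w] := @IVT _ F 0 c 0 (ltW c0).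
- exact: continuous_subspaceT.
- rewrite F0 Fc ge_min le_max oppr_le0 ler01/= (ltW ac) orbT//.
rewrite in_itv/= => /andP[w0 wc] Fw.
have {}w0 : 0 < w.
  rewrite lt_neqAle w0 andbT; apply: contraPneq Fw => <-; rewrite F0; lra.
have {}wc : w < c.
  rewrite lt_neqAle wc andbT; apply: contraPneq Fw => ->; rewrite Fc.
  by apply/eqP; rewrite gt_eqF.
have inpi x : 0 < x -> x < c -> - (pi / 2) < x * b < pi / 2.
  move=> x0 xc; rewrite (@lt_trans _ _ 0) ?oppr_lt0 ?mulr_gt0//=.
  by rewrite -ltr_pdivlMr.
have cpos x : 0 < x -> x < c -> 0 < cos (x * b).
  by move=> x0 xc; rewrite cos_gt0_pihalf ?inpi.
have rw : root_eq a w.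
  apply/root_eqE => //; first by rewrite gt_eqF ?cpos.
  by apply/eqP; rewrite -subr_eq0; apply/eqP.
exists w; last by rewrite -ltr_pdivlMr.
split=> // x x0 rx; rewrite leNgt; apply/negP => xw.
have : tan (x * b) < tan (w * b).
  rewrite ltr_tan ?ltr_pM2r//; rewrite in_itv/= inpi//; exact: lt_trans wc.
rewrite rx rw ltrD2l ltNge => /negP; apply.
by rewrite lef_pV2 ?posrE ?mulr_gt0// ler_pM2l// ltW.
Qed.

Lemma w_spec a : 0 < a -> a < 2^-1 ->
  first_positive_root a (w_ a) /\ w_ a * (2^-1 - a) < pi / 2.
Proof.
move=> a0 a2; have [w wP wlt] := first_positive_root_exists a0 a2.
have wa : first_positive_root a (w_ a) by apply: xgetPex; exists w.
split=> //; apply: le_lt_trans wlt; rewrite ler_pM2r ?subr_gt0//.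
by case: wa => _ _; apply; case: wP.
Qed.

Lemma le_w_ a : 0 < a -> a < 2^-1 -> pi / 4 <= w_ a * (2^-1 - a).
Proof.
move=> a0 a2; have [[w0 rw _] wlt] := w_spec a0 a2.
have pi0 := pi_gt0 R.
have b0 : 0 < 2^-1 - a by rewrite subr_gt0.
have wb0 := mulr_gt0 w0 b0.
rewrite leNgt; apply/negP => h.
have : tan (w_ a * (2^-1 - a)) < tan (pi / 4).
  by rewrite ltr_tan// in_itv/=; apply/andP; split; lra.
rewrite tan_piquarter rw ltNge => /negP; apply.
by rewrite lerDl invr_ge0 ltW// mulr_gt0.
Qed.

End first_root.

Section mu_g.
Context {R : realType}.
Variable a : R.
Hypotheses (a0 : 0 < a) (a2 : a < 2^-1).
Local Notation w := (w_ a).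

Let w0 : 0 < w. Proof. by have [[]] := w_spec a0 a2. Qed.
Let th2 : w * (2^-1 - a) < pi / 2. Proof. by have [] := w_spec a0 a2. Qed.

Let cos_pos x : `|x| <= 2^-1 - a -> 0 < cos (w * x).
Proof.
rewrite ler_norml => /andP[x1 x2]; apply: cos_gt0_pihalf; apply/andP; split.
  rewrite ltrNl (le_lt_trans _ th2)// -mulrN ler_wpM2l ?(ltW w0)//; lra.
by rewrite (le_lt_trans _ th2)// ler_wpM2l// ltW.
Qed.

Let A : R := cos (w * (2^-1 - a)) / (w * a).

Let cosE : cos (w * (2^-1 - a)) = A * (w * a).
Proof. by rewrite divfK// mulf_neq0// gt_eqF. Qed.

Let sinE : sin (w * (2^-1 - a)) = A * (1 + w * a).
Proof.
have [[_ rw _] _] := w_spec a0 a2.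
have c0 : 0 < cos (w * (2^-1 - a)) by rewrite cos_pos// ger0_norm// subr_ge0 ltW.
have c0' : cos (w * (2^-1 - a)) != 0 by rewrite gt_eqF.
have wa : w * a != 0 by rewrite mulf_neq0// gt_eqF.
have /root_eqE := rw; move=> /(_ a0 w0 c0') h.
by apply: (mulIf wa); rewrite [w * a]mulrC h /A; field; rewrite !gt_eqF.
Qed.

Let A0 : 0 < A.
Proof.
by rewrite divr_gt0 ?mulr_gt0// cos_pos// ger0_norm// subr_ge0 ltW.
Qed.

Let ea (x : R) := expR (w * (x - a)).
Let eb (x : R) := expR (w * (1 - x - a)).

Let ea_neq0 x : ea x != 0. Proof. by rewrite gt_eqF ?expR_gt0. Qed.
Let eb_neq0 x : eb x != 0. Proof. by rewrite gt_eqF ?expR_gt0. Qed.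
Let eaa : ea a = 1. Proof. by rewrite /ea subrr mulr0 expR0. Qed.
Let ebb : eb (1 - a) = 1.
Proof. by rewrite /eb -expR0; congr expR; ring. Qed.

Let dea (x : R) : is_derive x 1 ea (w * ea x).
Proof.
have h : is_derive x 1 (fun x => w * (x - a)) w.
  by apply: is_derive_eq; rewrite /GRing.scale/=; ring.
rewrite mulrC; exact: (@is_derive1_comp _ expR (fun x => w * (x - a))).
Qed.

Let deb (x : R) : is_derive x 1 eb (- w * eb x).
Proof.
have h : is_derive x 1 (fun x => w * (1 - x - a)) (- w).
  by apply: is_derive_eq; rewrite /GRing.scale/=; ring.
rewrite mulrC; exact: (@is_derive1_comp _ expR (fun x => w * (1 - x - a))).
Qed.

Let dcos (x : R) :
  is_derive x 1 (fun x => cos (w * (2^-1 - x))) (w * sin (w * (2^-1 - x))).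
Proof.
have h : is_derive x 1 (fun x => w * (2^-1 - x)) (- w).
  by apply: is_derive_eq; rewrite /GRing.scale/=; ring.
rewrite -mulrNN mulrC; exact: (@is_derive1_comp _ cos (fun x => w * (2^-1 - x))).
Qed.

Let dsin (x : R) :
  is_derive x 1 (fun x => sin (w * (2^-1 - x))) (- w * cos (w * (2^-1 - x))).
Proof.
have h : is_derive x 1 (fun x => w * (2^-1 - x)) (- w).
  by apply: is_derive_eq; rewrite /GRing.scale/=; ring.
rewrite mulrC; exact: (@is_derive1_comp _ sin (fun x => w * (2^-1 - x))).
Qed.

Let g : R -> R :=
  splice a (fun x => ea x ^+ 2) (splice (1 - a) (cst 1) (fun x => eb x ^+ 2)).
Let y : R -> R := splice a (fun x => A * (1 + w * x) / ea x)
  (splice (1 - a) (fun x => sin (w * (2^-1 - x)))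
     (fun x => - (A * (1 + w * (1 - x)) / eb x))).
Let y' : R -> R := splice a (fun x => - (A * w ^+ 2 * x / ea x))
  (splice (1 - a) (fun x => - w * cos (w * (2^-1 - x)))
     (fun x => - (A * w ^+ 2 * (1 - x) / eb x))).
Let G : R -> R := splice a (fun x => - (A * w ^+ 2 * x * ea x))
  (splice (1 - a) (fun x => - w * cos (w * (2^-1 - x)))
     (fun x => - (A * w ^+ 2 * (1 - x) * eb x))).
Let G' : R -> R := splice a (fun x => - (A * w ^+ 2 * (1 + w * x) * ea x))
  (splice (1 - a) (fun x => - w * (w * sin (w * (2^-1 - x))))
     (fun x => A * w ^+ 2 * (1 + w * (1 - x)) * eb x)).

Let a1a : a < 1 - a. Proof. by have := a2; lra. Qed.

Let half_1a : w * (2^-1 - (1 - a)) = - (w * (2^-1 - a)).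
Proof. by field. Qed.

Let sin_1a : sin (w * (2^-1 - (1 - a))) = - (A * (1 + w * a)).
Proof. by rewrite half_1a sinN sinE. Qed.

Let cos_1a : cos (w * (2^-1 - (1 - a))) = A * (w * a).
Proof. by rewrite half_1a cosN cosE. Qed.

Let inner f1 f2 : splice (1 - a) f1 f2 a = f1 a.
Proof. by rewrite /splice a1a. Qed.

Let gE : g_ a = g.
Proof.
apply/funext => x; rewrite /g_ /g /splice; case: ifP => _.
  by rewrite /ea -expRM_natl; congr expR; ring.
have e2 : expR (2 * w * (1 - x - a)) = eb x ^+ 2.
  by rewrite /eb -expRM_natl; congr expR; ring.
have [xa|xa|->] := ltgtP x (1 - a) => //.
by rewrite ebb expr1n.
Qed.

Let g_gt0 x : 0 < g x.
Proof.
by rewrite /g /splice; case: ifP => _; last case: ifP => _ //=;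
  rewrite exprn_gt0// expR_gt0.
Qed.

Let g_continuous : continuous g.
Proof.
have c2 (k dk : R -> R) : (forall x : R, is_derive x 1 k (dk x)) ->
    continuous (fun x => k x ^+ 2).
  by move=> /is_derive_continuous ck x; apply: (@cvgM _ _ _ _ k k); exact: ck.
apply: continuous_splice; first exact: c2 dea.
  apply: continuous_splice; [by move=> x; exact: cvg_cst|exact: c2 deb|].
  by rewrite ebb expr1n.
by rewrite inner eaa expr1n.
Qed.

Let y'E x : y' x = G x / g x.
Proof.
have ea0 := ea_neq0 x; have eb0 := eb_neq0 x.
rewrite /y' /G /g /splice; case: ifP => _; last case: ifP => _.
- by field.
- by rewrite divr1.
- by field.
Qed.

Let G'E x : G' x = - (w ^+ 2 * g x * y x).
Proof.
have ea0 := ea_neq0 x; have eb0 := eb_neq0 x.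
rewrite /G' /g /y /splice; case: ifP => _; last case: ifP => _.
- by field.
- by rewrite /=; ring.
- by field.
Qed.

Let dy (x : R) : is_derive x 1 y (G x / g x).
Proof.
have d1 (z : R) : is_derive z 1 (fun x => A * (1 + w * x) / ea x)
    (- (A * w ^+ 2 * z / ea z)).
  have ez := ea_neq0 z; apply: is_derive_eq; rewrite /GRing.scale/= -/(ea z).
  by field.
have d3 (z : R) : is_derive z 1 (fun x => - (A * (1 + w * (1 - x)) / eb x))
    (- (A * w ^+ 2 * (1 - z) / eb z)).
  have ez := eb_neq0 z; apply: is_derive_eq; rewrite /GRing.scale/= -/(eb z).
  by field.
rewrite -y'E; refine (is_derive_splice d1 (is_derive_splice dsin d3 _ _) _ _ x).
- by rewrite sin_1a ebb; field.
- by rewrite cos_1a ebb; field.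
- by rewrite inner eaa sinE; field.
- by rewrite inner eaa cosE; field.
Qed.

Let dG (x : R) : is_derive x 1 G (- (w ^+ 2 * g x * y x)).
Proof.
have d1 (z : R) : is_derive z 1 (fun x => - (A * w ^+ 2 * x * ea x))
    (- (A * w ^+ 2 * (1 + w * z) * ea z)).
  by apply: is_derive_eq; rewrite /GRing.scale/= -/(ea z); ring.
have d2 (z : R) : is_derive z 1 (fun x => - w * cos (w * (2^-1 - x)))
    (- w * (w * sin (w * (2^-1 - z)))).
  exact: is_deriveZ.
have d3 (z : R) : is_derive z 1 (fun x => - (A * w ^+ 2 * (1 - x) * eb x))
    (A * w ^+ 2 * (1 + w * (1 - z)) * eb z).
  by apply: is_derive_eq; rewrite /GRing.scale/= -/(eb z); ring.
rewrite -G'E; refine (is_derive_splice d1 (is_derive_splice d2 d3 _ _) _ _ x).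
- by rewrite cos_1a ebb; ring.
- by rewrite sin_1a ebb; ring.
- by rewrite inner eaa cosE; ring.
- by rewrite inner eaa sinE; ring.
Qed.

Let G_lt0 x : unit_itv R x -> G x < 0.
Proof.
rewrite /unit_itv /= in_itv/= => /andP[x0 x1].
have Aw : 0 < A * w ^+ 2 by rewrite mulr_gt0// exprn_gt0.
rewrite /G /splice; have [xa|ax] := ltP x a.
  by rewrite oppr_lt0 mulr_gt0 ?expR_gt0// mulr_gt0.
have [xa|xa] := ltP x (1 - a).
  rewrite mulNr oppr_lt0 mulr_gt0// cos_pos// ler_norml; apply/andP; split; lra.
by rewrite oppr_lt0 mulr_gt0 ?expR_gt0// mulr_gt0// subr_gt0.
Qed.

Lemma mu_1_g_ : mu_ 1 (g_ a) = (w ^+ 2)%:E.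
Proof.
rewrite gE; apply: (mu_1_eigenvalue _ g_continuous g_gt0 dy dG _ _ G_lt0).
- by rewrite exprn_gt0.
- by rewrite /G /splice a0 mulr0 mul0r oppr0.
- have a1 : (1 < a) = false by apply/negbTE; rewrite -leNgt; have := a2; lra.
  have a1' : (1 < 1 - a) = false by apply/negbTE; rewrite -leNgt; have := a0; lra.
  by rewrite /G /splice a1 a1' subrr mulr0 mul0r oppr0.
Qed.

End mu_g.

Unset Implicit Arguments.

Theorem proposition6p1 (R : realType) :
  (forall a : R, 0 < a -> a < 2^-1 ->
     first_positive_root a (w_ a) /\ mu_ 1 (g_ a) = ((w_ a) ^+ 2)%:E) /\
  mu_ 1 (g_ a) @[a --> (2^-1 : R)^'-] --> +oo%E.
Proof.
split=> [a a0 a2|]; first by split; [have [] := w_spec a0 a2|exact: mu_1_g_].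
apply/cvgeyPge => B; pose M : R := `|B| + 1.
have M1 : 1 <= M by rewrite lerDr.
have BM : B <= M by rewrite (le_trans (ler_norm B))// lerDl.
have M0 : 0 < M by exact: lt_le_trans M1.
have pi0 := pi_gt0 R; have e0 : 0 < pi / 4 / M by rewrite !divr_gt0.
near=> a.
have a0 : 0 < a by near: a; apply: nbhs_left_gt; rewrite invr_gt0.
have a2 : a < 2^-1 by near: a; exact: nbhs_left_lt.
have ae : 2^-1 - pi / 4 / M < a by near: a; apply: nbhs_left_gt; rewrite ltrBlDr ltrDl.
rewrite mu_1_g_// lee_fin.
have b0 : 0 < 2^-1 - a by rewrite subr_gt0.
have Mw : M <= w_ a.
  rewrite -(ler_pM2r b0) (le_trans _ (le_w_ a0 a2))// -ler_pdivlMl//.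
  by rewrite mulrC; lra.
by nra.
Unshelve. all: by end_near. Qed.
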